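(* Let $\ell, n$ be positive integers with $\ell \leq n$. For every subgroup $G \leq S_\ell$, $\operatorname{gPat}^{(\ell)} \operatorname{gComp}^{(n)} G = \operatorname{Aut} \operatorname{pcExt} G$.
   Context: $[n] := \{1,\dots,n\}$; $\mathcal{P}_\ell(n)$ is the set of all $\ell$-element subsets of $[n]$; $S_n$ is the symmetric group on $[n]$; $\langle T \rangle$ is the subgroup generated by $T$. Arities $k$ are positive integers. A map is applied to a tuple componentwise, and $\operatorname{Im}\mathbf{r}$ is the set of entries of the tuple $\mathbf{r}$. Patterns: for $I \in \mathcal{P}_\ell(n)$, $h_I \colon [\ell] \to I$ is the unique order-isomorphism. For $\pi \in S_n$, $\pi_I := h_{\pi(I)}^{-1} \circ \pi|_I \circ h_I \in S_\ell$, and $\operatorname{Pat}^{(\ell)} \pi := \{\pi_I \mid I \in \mathcal{P}_\ell(n)\}$. For subgroups $G \leq S_\ell$ and $H \leq S_n$, $$\operatorname{gComp}^{(n)} G := \{\tau \in S_n \mid \operatorname{Pat}^{(\ell)} \tau \subseteq G\}, \qquad \operatorname{gPat}^{(\ell)} H := \Bigl\langle \bigcup_{\tau \in H} \operatorname{Pat}^{(\ell)} \tau \Bigr\rangle \leq S_\ell$$ ($\operatorname{gComp}^{(n)} G$ is a subgroup of $S_n$). Relations: for $k \leq \ell$, $\rho \subseteq [n]^k$ and $\sigma \subseteq [\ell]^k$, define $$\rho^{\lor} := \{h_I^{-1}(\mathbf{r}) \mid \mathbf{r} \in \rho,\ \operatorname{Im}\mathbf{r} \subseteq I \in \mathcal{P}_\ell(n)\}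 \subseteq [\ell]^k, \qquad \sigma^{\land} := \{h_J(\mathbf{s}) \mid \mathbf{s} \in \sigma,\ J \in \mathcal{P}_\ell(n)\} \subseteq [n]^k .$$ For $m \in \{\ell, n\}$, a permutation $\pi \in S_m$ preserves a relation $\rho \subseteq [m]^k$ if $\pi(\mathbf{r}) \in \rho$ for all $\mathbf{r} \in \rho$. For a relation or set of relations $R$ on $[m]$, $\operatorname{Aut} R$ is the set of $\pi \in S_m$ preserving (every relation in) $R$; for $T \subseteq S_m$, $\operatorname{Inv} T$ is the set of all finitary relations on $[m]$ preserved by every $\pi \in T$. For $G \leq S_\ell$, $\gamma_G \subseteq [\ell]^\ell$ denotes $G$ viewed as an $\ell$-ary relation: $\gamma_G := \{(\pi(1),\dots,\pi(\ell)) \mid \pi \in G\}$. The set $\operatorname{pcExt} G$ of pattern closed extended invariants of $G$ consists of all relations $\sigma \subseteq [\ell]^k$, $k \leq \ell$, such that $(\sigma^{\land})^{\lor} = \sigma$ and $\sigma^{\land} \in \operatorname{Inv} \operatorname{Aut} ((\gamma_G)^{\land})$. *)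

(* Defs.v *)
Set Warnings "-notation-overridden".
From mathcomp Require Import all_boot all_order all_fingroup.
From mathcomp Require Import boolp.

Set Implicit Arguments.
Unset Strict Implicit.
Unset Printing Implicit Defensive.

Import GroupScope.

(* Every set [m] = {1, ..., m} is rendered as 'I_m = {0, ..., m - 1} with its
   usual order. *)

Definition ksub (l n : nat) := {I : {set 'I_n} | #|I| == l}.

Coercion ksub_set l n (I : ksub l n) : {set 'I_n} := val I.

Section OrderIsomorphism.
Variables (l n : nat) (I : ksub l n).

Definition h (i : 'I_l) : {x | x \in (I : {set 'I_n})} :=
  let j := cast_ord (esym (eqP (valP I))) i in
  exist _ (Order.enum_val j) (Order.enum_valP j).

Definition hinv (x : {x | x \in (I : {set 'I_n})}) : 'I_l :=
  cast_ord (eqP (valP I)) (Order.enum_rank_in (valP x) (val x)).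

Lemma hK : cancel h hinv.
Proof.
by move=> i; rewrite /hinv /h /= Order.enum_valK_in cast_ord_comp cast_ord_id.
Qed.

Lemma hinvK : cancel hinv h.
Proof.
move=> x; apply: val_inj; rewrite /hinv /h /= cast_ord_comp cast_ord_id.
exact: Order.enum_rankK_in (valP x).
Qed.

Lemma h_mono : {mono (fun i => val (h i)) : i j / (i <= j)%N}.
Proof.
move=> i j.
have leE m (a b : 'I_m) : (a <= b)%N = (a <= b)%O by [].
by rewrite leE /h /= Order.le_enum_val; last exact: Order.TotalTheory.le_total.
Qed.

End OrderIsomorphism.

Section Patterns.
Variables (l n : nat).

Lemma card_perm_image (pi : 'S_n) (I : ksub l n) : #|pi @: I| == l.
Proof. by rewrite card_imset ?(eqP (valP I)) //; exact: perm_inj. Qed.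

Definition perm_image (pi : 'S_n) (I : ksub l n) : ksub l n :=
  exist _ (pi @: I) (card_perm_image pi I).

Definition perm_restr (pi : 'S_n) (I : ksub l n)
    (x : {x | x \in (I : {set 'I_n})}) :
    {y | y \in (perm_image pi I : {set 'I_n})} :=
  exist _ (pi (val x)) (imset_f pi (valP x)).

Definition pattern_fun (pi : 'S_n) (I : ksub l n) : 'I_l -> 'I_l :=
  @hinv l n (perm_image pi I) \o @perm_restr pi I \o @h l n I.

Lemma pattern_inj (pi : 'S_n) (I : ksub l n) : injective (pattern_fun pi I).
Proof.
apply: inj_comp (can_inj (@hK l n I)).
apply: inj_comp (can_inj (@hinvK l n _)) _.
by move=> x y /(congr1 val) /= /perm_inj /val_inj.
Qed.

Definition pattern (pi : 'S_n) (I : ksub l n) : 'S_l :=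
  perm (@pattern_inj pi I).

Definition Pat (pi : 'S_n) : {set 'S_l} := [set pattern pi I | I : ksub l n].

End Patterns.
Arguments Pat l {n} pi.

Lemma patternE l n (pi : 'S_n) (I : ksub l n) i :
  val (h (perm_image pi I) (pattern pi I i)) = pi (val (h I i)).
Proof. by rewrite permE /pattern_fun /comp hinvK. Qed.

Lemma h_ext l n (I J : ksub l n) i j :
  I = J -> val (h I i) = val (h J j) -> i = j.
Proof. by move=> -> /val_inj /(can_inj (@hK _ _ _)). Qed.

Section Galois.
Variables (l n : nat).

Definition gComp_set (G : {set 'S_l}) : {set 'S_n} :=
  [set tau | Pat l tau \subset G].

Lemma gComp_group_set (G : {group 'S_l}) : group_set (gComp_set G).
Proof.
apply/group_setP; split=> [|s t].
  rewrite inE; apply/subsetP => _ /imsetP[I _ ->].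
  suff -> : pattern 1 I = 1 by [].
  apply/permP => i; rewrite [RHS]perm1; apply: (@h_ext l n (perm_image 1 I) I).
    by apply: val_inj; rewrite /= -[RHS]imset_id; apply: eq_imset => x; rewrite perm1.
  by rewrite patternE perm1.
rewrite !inE => /subsetP sG /subsetP tG.
apply/subsetP => _ /imsetP[I _ ->].
suff -> : pattern (s * t) I = pattern s I * pattern t (perm_image s I).
  by apply: groupM; [apply: sG | apply: tG]; apply/imsetP; eexists.
apply/permP => i; rewrite [RHS]permM.
apply: (@h_ext l n (perm_image (s * t) I) (perm_image t (perm_image s I))).
  by apply: val_inj; rewrite /= -imset_comp; apply: eq_imset => x; rewrite permM.
by rewrite !patternE permM.
Qed.

Definition gComp (G : {group 'S_l}) : {group 'S_n} := group (gComp_group_set G).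

Definition gPat (H : {group 'S_n}) : {group 'S_l} :=
  <<\bigcup_(tau in H) Pat l tau>>%G.

End Galois.
Arguments gComp {l} n G.
Arguments gPat l {n} H.

Definition krel (m k : nat) := {set k.-tuple 'I_m}.

Definition relset (m : nat) := forall k : nat, krel m k -> Prop.

Section Relations.
Variable (m : nat).

Definition preserves k (pi : 'S_m) (rho : krel m k) : bool :=
  [forall r in rho, map_tuple pi r \in rho].

Definition autRel k (rho : krel m k) : {set 'S_m} :=
  [set pi | preserves pi rho].

Definition autRels (R : relset m) : {set 'S_m} :=
  [set pi : 'S_m | `[< forall k (rho : krel m k), R k rho -> preserves pi rho >]].

(* Arities are positive. *)
Definition invRels (T : {set 'S_m}) : relset m :=
  fun k rho => (0 < k)%N /\ {in T, forall pi, preserves pi rho}.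

Definition gamma (G : {set 'S_m}) : krel m m :=
  [set [tuple pi i | i < m] | pi : 'S_m in G].

End Relations.

Section UpDown.
Variables (l n : nat).

(* A tuple r with entries in [n] and Im r included in I is the same thing as a
   tuple of elements of the subtype I, on which hinv I is defined. *)
Definition down k (rho : krel n k) : krel l k :=
  \bigcup_(I : ksub l n)
    [set map_tuple (@hinv l n I) r
      | r : k.-tuple {x | x \in (I : {set 'I_n})} & map_tuple val r \in rho].

Definition up k (sigma : krel l k) : krel n k :=
  \bigcup_(J : ksub l n)
    [set map_tuple (fun i => val (h J i)) s | s in sigma].

End UpDown.
Arguments down l {n k} rho.
Arguments up {l} n {k} sigma.

Definition pcExt l n (G : {group 'S_l}) : relset l :=
  fun k sigma =>
    [/\ (0 < k <= l)%N,
        down l (up n sigma) = sigma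
      & invRels (autRel (up n (gamma G))) (up n sigma)].
Arguments pcExt {l} n G k sigma.

(* Main.v *)
(** Since [tau \o h_J = h_(tau J) \o tau_J], a permutation [tau] preserves
    [up n (gamma G)] iff all its patterns lie in [G]; so the automorphism group
    of that relation is [gComp n G].  The same identity shows that every pattern
    of such a [tau] preserves every relation of [pcExt n G].  Conversely
    [gamma P], for [P] the group generated by these patterns, belongs to
    [pcExt n G], and only the elements of [P] preserve it. *)
Require Import Defs.
From mathcomp Require Import all_boot all_order all_fingroup.
From mathcomp Require Import boolp.

Set Implicit Arguments.
Unset Strict Implicit.
Unset Printing Implicit Defensive.

Import GroupScope.

Section RelationLemmas.
Variable m : nat.

Lemma mem_gamma (A : {set 'S_m}) (pi : 'S_m) :
  ([tuple pi i | i < m] \in gamma A) = (pi \in A).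
Proof.
apply/imsetP/idP => [[rho rhoA e] | piA]; last by exists pi.
suff -> : pi = rho by [].
by apply/permP => i; move/(congr1 (fun t => tnth t i)): e; rewrite !tnth_mktuple.
Qed.

(** A permutation [t] acts on the tuples of [gamma P] as right multiplication by [t]. Applied to the
    tuple of the identity, this already forces [t \in P]. *)
Lemma autRel_gamma (P : {group 'S_m}) : autRel (gamma P) = P.
Proof.
have actE (s t : 'S_m) :
    map_tuple t [tuple s i | i < m] = [tuple (s * t) i | i < m].
  by apply: eq_from_tnth => i; rewrite tnth_map !tnth_mktuple permM.
apply/setP => t; rewrite inE; apply/forall_inP/idP => [Pt | tP _ /imsetP[s sP ->]].
  by have := Pt _ (etrans (mem_gamma P 1) (group1 P)); rewrite actE mem_gamma mul1g.
by rewrite actE mem_gamma groupM.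
Qed.

Lemma autRels_group_set (R : relset m) : group_set (autRels R).
Proof.
apply/group_setP; split=> [|s t].
  rewrite inE; apply/asboolP => k rho _; apply/forall_inP => r r_rho.
  suff -> : map_tuple (1 : 'S_m) r = r by [].
  by apply: eq_from_tnth => i; rewrite tnth_map perm1.
rewrite !inE => /asboolP sR /asboolP tR; apply/asboolP => k rho Rrho.
apply/forall_inP => r r_rho.
suff -> : map_tuple (s * t) r = map_tuple t (map_tuple s r).
  by move/forall_inP: (tR k rho Rrho); apply; move/forall_inP: (sR k rho Rrho); apply.
by apply: eq_from_tnth => i; rewrite !tnth_map permM.
Qed.

End RelationLemmas.

Section UpDownLemmas.
Variables l n : nat.

Lemma upP k (sigma : krel l k) (t : k.-tuple 'I_n) :
  reflect (exists J : ksub l n, exists2 s, s \in sigma &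
             t = map_tuple (fun i => val (h J i)) s)
          (t \in up n sigma).
Proof.
apply: (iffP bigcupP) => [[J _ /imsetP[s ss ->]] | [J [s ss ->]]].
  by exists J, s.
by exists J => //; apply: imset_f.
Qed.

(** Since [hinv I] inverts [h I], tuples over the subtype of [I] can be traded for tuples in
    [[l]]. *)
Lemma downP k (rho : krel n k) (s : k.-tuple 'I_l) :
  reflect (exists I : ksub l n, map_tuple (fun i => val (h I i)) s \in rho)
          (s \in down l rho).
Proof.
apply: (iffP bigcupP) => [[I _ /imsetP[r r_rho ->]] | [I s_rho]].
  rewrite inE in r_rho; exists I.
  suff -> : map_tuple (fun i => val (h I i)) (map_tuple (@hinv l n I) r)
                      = map_tuple val r by [].
  by apply: eq_from_tnth => i; rewrite !tnth_map hinvK.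
exists I => //; apply/imsetP; exists (map_tuple (@h l n I) s).
  rewrite inE; suff -> : map_tuple val (map_tuple (@h l n I) s)
                         = map_tuple (fun i => val (h I i)) s by [].
  by apply: eq_from_tnth => i; rewrite !tnth_map.
by apply: eq_from_tnth => i; rewrite !tnth_map hK.
Qed.

Lemma map_h_pattern k (tau : 'S_n) (J : ksub l n) (s : k.-tuple 'I_l) :
  map_tuple tau (map_tuple (fun i => val (h J i)) s) =
  map_tuple (fun i => val (h (perm_image tau J) i)) (map_tuple (pattern tau J) s).
Proof. by apply: eq_from_tnth => i; rewrite !tnth_map patternE. Qed.

(* The entries of [h_J(p)] determine [J] because [p] is surjective. *)
Lemma map_h_perm_inj (J K : ksub l n) (p q : 'S_l) :
  map_tuple (fun i => val (h J i)) [tuple p i | i < l] =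
  map_tuple (fun i => val (h K i)) [tuple q i | i < l] -> J = K /\ p = q.
Proof.
move=> e.
have {}e i : val (h J (p i)) = val (h K (q i)).
  by move/(congr1 (fun t => tnth t i)): e; rewrite !tnth_map !tnth_ord_tuple.
have eJK : J = K.
  apply: val_inj; apply/eqP; rewrite eqEcard (eqP (valP J)) (eqP (valP K)) leqnn andbT.
  apply/subsetP => x xJ; pose y : {x | x \in (J : {set 'I_n})} := exist _ x xJ.
  suff -> : x = val (h K (q (p^-1 (@hinv l n J y)))) by exact: valP.
  by rewrite -e permKV hinvK.
by split=> //; apply/permP => i; apply: h_ext eJK (e i).
Qed.

(** A tuple of [gamma A] uses all of [[l]], so its image under [h J] can only be pulled back along
    [J] itself. *)
Lemma down_up_gamma (A : {set 'S_l}) : l <= n -> down l (up n (gamma A)) = gamma A.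
Proof.
move=> l_le_n; apply/setP => s; apply/downP/idP => [[I /upP[J [_ /imsetP[p pA ->]]]] e|sA].
  suff [q eq_s] : exists q : 'S_l, s = [tuple q i | i < l].
    by move: e; rewrite eq_s => /map_h_perm_inj[_ ->]; rewrite mem_gamma.
  (* A priori [s] is an arbitrary tuple; it inherits distinct entries from [p], hence is a
     permutation of [[l]]. *)
  have s_inj : injective (tnth s).
    move=> i j eij; apply: (@perm_inj _ p).
    apply: (can_inj (@hK l n J)); apply: val_inj.
    have eS a : val (h I (tnth s a)) = val (h J (p a)).
      by move/(congr1 (fun t => tnth t a)): e; rewrite !tnth_map !tnth_ord_tuple.
    by rewrite -!eS eij.
  by exists (perm s_inj); apply: eq_from_tnth => i; rewrite tnth_mktuple permE.
(* Any [l]-element subset serves to lift [s]; the initial segment exists because [l <= n]. *)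
have cardI : #|[set widen_ord l_le_n i | i : 'I_l]| == l.
  by rewrite card_imset ?card_ord // => i j /(congr1 val) /= /val_inj.
pose I : ksub l n := exist (fun I : {set 'I_n} => #|I| == l) _ cardI.
by exists I; apply/upP; exists I, s.
Qed.

Lemma autRel_up_gamma (G : {group 'S_l}) :
  autRel (up n (gamma G)) = gComp n G.
Proof.
have patM (tau : 'S_n) (J : ksub l n) (g : 'S_l) :
    map_tuple (pattern tau J) [tuple g i | i < l] =
    [tuple (g * pattern tau J) i | i < l].
  by apply: eq_from_tnth => i; rewrite tnth_map !tnth_mktuple permM.
apply/setP => tau; rewrite !inE; apply/forall_inP/subsetP => [tauP _ /imsetP[J _ ->]|tauG].
  (* The lifted identity tuple is a test element: [tau] sends it to the lift of [pattern tau J]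
     along the image of [J]. *)
  have /tauP : map_tuple (fun i => val (h J i)) [tuple (1 : 'S_l) i | i < l]
                 \in up n (gamma G).
    by apply/upP; exists J; exists [tuple (1 : 'S_l) i | i < l]; rewrite ?mem_gamma.
  rewrite map_h_pattern patM mul1g => /upP[K [_ /imsetP[g gG ->]]].
  by case/map_h_perm_inj => _ ->.
move=> _ /upP[J [_ /imsetP[g gG ->] ->]]; rewrite map_h_pattern patM.
apply/upP; exists (perm_image tau J), [tuple (g * pattern tau J) i | i < l] => //.
by rewrite mem_gamma groupM //; apply/tauG/imset_f.
Qed.

End UpDownLemmas.

Theorem theorem5p10 (l n : nat) (l_gt0 : (0 < l)%N) (l_le_n : (l <= n)%N)
    (G : {group 'S_l}) :
  gPat l (gComp n G) = autRels (pcExt n G) :> {set 'S_l}.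
Proof.
apply/eqP; rewrite eqEsubset; apply/andP; split.
  (* As the right-hand side is a group, it suffices to treat the generators of [gPat], the single
     patterns. *)
  rewrite (gen_subG _ (group (autRels_group_set _))).
  apply/bigcupsP => tau tauH; apply/subsetP => _ /imsetP[I _ ->].
  rewrite inE; apply/asboolP => k sigma [_ sigmaK [_ sigmaInv]].
  (* Lift [s] along [I], apply [tau], and come back down along the image of [I]. *)
  apply/forall_inP => s s_sigma; rewrite -sigmaK; apply/downP.
  exists (perm_image tau I); rewrite -map_h_pattern.
  rewrite -autRel_up_gamma in tauH.
  by move/forall_inP: (sigmaInv _ tauH); apply; apply/upP; exists I, s.
apply/subsetP => pi; rewrite inE => /asboolP piP.
(* Membership in the generated group becomes preservation of its [gamma], so [piP] applies once this
   relation is shown to lie in [pcExt n G]. *)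
rewrite -(autRel_gamma (gPat l (gComp n G))) inE; apply: piP; split.
- by rewrite l_gt0 leqnn.
- exact: down_up_gamma.
split=> // tau; rewrite autRel_up_gamma => tauH.
apply/forall_inP => _ /upP[J [s sP ->]]; rewrite map_h_pattern.
apply/upP; exists (perm_image tau J), (map_tuple (pattern tau J) s) => //.
(* This pattern is one of the generators, so it preserves [gamma] of the group they generate. *)
have: pattern tau J \in autRel (gamma (gPat l (gComp n G))).
  rewrite autRel_gamma; apply: mem_gen; apply/bigcupP.
  by exists tau => //; apply: imset_f.
by rewrite inE => /forall_inP; apply.
Qed.
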